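(* The triple $\mathbb I=(I,\eta,\zeta)$ is a monad on the category of compact Hausdorff spaces and continuous maps.
   Context: For a compact Hausdorff space $X$, $C(X)$ is the Banach space of continuous real-valued functions on $X$ with the sup-norm; $c_X\in C(X)$ is the constant function with value $c\in\mathbb R$; $c\odot\varphi=c_X+\varphi$ for $c\in\mathbb R$, $\varphi\in C(X)$, and $\varphi\oplus\psi=\max\{\varphi,\psi\}$ (pointwise); for real numbers $a\odot b=a+b$, $a\oplus b=\max\{a,b\}$. An idempotent probability measure on $X$ is a functional $\mu\colon C(X)\to\mathbb R$ such that $\mu(c_X)=c$, $\mu(c\odot\varphi)=c\odot\mu(\varphi)$ and $\mu(\varphi\oplus\psi)=\mu(\varphi)\oplus\mu(\psi)$ for all $c\in\mathbb R$, $\varphi,\psi\in C(X)$. $I(X)$ is the set of all idempotent probability measures on $X$ with the weak* topology, whose base consists of the sets $\{\nu\in I(X)\mid |\mu(\varphi_i)-\nu(\varphi_i)|<\varepsilon,\ i=1,\dots,n\}$, where $\mu\in I(X)$, $\varphi_1,\dots,\varphi_n\in C(X)$, $\varepsilon>0$; the space $I(X)$ is compact Hausdorff. For a continuous map $f\colon X\to Y$ of compact Hausdorff spaces, $I(f)\colon I(X)\to I(Y)$ is defined by $I(f)(\mu)(\varphi)=\mu(\varphi\circ f)$, $\varphi\in C(Y)$. This makes $I$ a covariant endofunctor of the category of compact Hausdorff spaces and continuous maps. The map $\eta_X\colon X\to I(X)$ is $\eta_X(x)=\delta_x$, where $\delta_x(\varphi)=\varphi(x)$, $\varphi\in C(X)$.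 For $\varphi\in C(X)$ let $\bar\varphi\colon I(X)\to\mathbb R$ be the continuous function $\bar\varphi(\mu)=\mu(\varphi)$. The map $\zeta_X\colon I^2(X)=I(I(X))\to I(X)$ is defined by $\zeta_X(M)(\varphi)=M(\bar\varphi)$, $M\in I^2(X)$, $\varphi\in C(X)$. Set $\eta=(\eta_X)$, $\zeta=(\zeta_X)$. A monad $(T,\eta,\mu)$ on a category $\mathcal E$ consists of an endofunctor $T\colon\mathcal E\to\mathcal E$ and natural transformations $\eta\colon 1_{\mathcal E}\to T$ and $\mu\colon T^2\to T$ satisfying $\mu\circ T\eta=\mu\circ\eta T=\mathbf 1_T$ and $\mu\circ\mu T=\mu\circ T\mu$. *)

(* Defs.v *)
From HB Require Import structures.
From mathcomp Require Import all_boot all_order all_algebra.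
From mathcomp Require Import all_classical all_reals all_analysis.

Set Implicit Arguments.
Unset Strict Implicit.
Unset Printing Implicit Defensive.

Import Order.TTheory GRing.Theory Num.Theory.
Import numFieldNormedType.Exports.

Local Open Scope classical_set_scope.
Local Open Scope ring_scope.

Record category := Category {
  obj :> Type;
  hom : obj -> obj -> Type;
  cat_id : forall a, hom a a;
  cat_comp : forall a b c, hom b c -> hom a b -> hom a c;
  cat_comp1l : forall a b (f : hom a b), cat_comp (cat_id b) f = f;
  cat_comp1r : forall a b (f : hom a b), cat_comp f (cat_id a) = f;
  cat_compA : forall a b c d (h : hom c d) (g : hom b c) (f : hom a b),
    cat_comp h (cat_comp g f) = cat_comp (cat_comp h g) f }.

Arguments hom {C} _ _ : rename.
Arguments cat_id {C} a : rename.
Arguments cat_comp {C a b c} _ _ : rename.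

Record functor (C D : category) := Functor {
  fobj :> C -> D;
  fhom : forall a b, hom a b -> hom (fobj a) (fobj b);
  fhom1 : forall a, fhom (cat_id a) = cat_id (fobj a);
  fhomM : forall a b c (g : hom b c) (f : hom a b),
    fhom (cat_comp g f) = cat_comp (fhom g) (fhom f) }.

Arguments fhom {C D} _ {a b} _.

Definition id_functor (C : category) : functor C C :=
  @Functor C C (fun a => a) (fun a b f => f)
    (fun=> erefl) (fun _ _ _ _ _ => erefl).

Section CompFunctor.
Variables (C D E : category) (G : functor D E) (F : functor C D).

Let comp_fhom a b (f : hom a b) : hom (G (F a)) (G (F b)) := fhom G (fhom F f).

Lemma comp_fhom1 a : comp_fhom (cat_id a) = cat_id (G (F a)).
Proof. by rewrite /comp_fhom !fhom1. Qed.

Lemma comp_fhomM a b c (g : hom b c) (f : hom a b) :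
  comp_fhom (cat_comp g f) = cat_comp (comp_fhom g) (comp_fhom f).
Proof. by rewrite /comp_fhom !fhomM. Qed.

Definition comp_functor : functor C E := Functor comp_fhom1 comp_fhomM.

End CompFunctor.

Record nat_trans (C D : category) (F G : functor C D) := NatTrans {
  component :> forall a : C, hom (F a) (G a);
  naturality : forall (a b : C) (f : hom a b),
    cat_comp (component b) (fhom F f) = cat_comp (fhom G f) (component a) }.

(* [(T eta)_a] is [fhom T (eta a)] and [(eta T)_a] is [eta (T a)]; the
   equations between natural transformations are stated componentwise. *)
Record is_monad (C : category) (T : functor C C)
    (eta : nat_trans (id_functor C) T)
    (mu : nat_trans (comp_functor T T) T) : Prop := IsMonad {
  monad_unitr : forall a : C, cat_comp (mu a) (fhom T (eta a)) = cat_id (T a);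
  monad_unitl : forall a : C, cat_comp (mu a) (eta (T a)) = cat_id (T a);
  monad_assoc : forall a : C,
    cat_comp (mu a) (mu (T a)) = cat_comp (mu a) (fhom T (mu a)) }.

Record compHaus := CompHaus {
  ch_sort :> topologicalType;
  ch_compact : compact [set: ch_sort];
  ch_hausdorff : hausdorff_space ch_sort }.

Section ContinuousMaps.
Variables X Y Z W : topologicalType.

Definition cts_id : continuousType X X := @idfun X.

Definition cts_comp (g : continuousType Y Z) (f : continuousType X Y) :
  continuousType X Z := g \o f.

Lemma cts_comp1l (f : continuousType X Y) : (idfun \o f : continuousType X Y) = f.
Proof. exact/continuousEP. Qed.

Lemma cts_comp1r (f : continuousType X Y) : (f \o idfun : continuousType X Y) = f.
Proof. exact/continuousEP. Qed.

Lemma cts_compA (h : continuousType Z W) (g : continuousType Y Z)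
    (f : continuousType X Y) :
  (h \o (g \o f) : continuousType X W) = (h \o g) \o f.
Proof. exact/continuousEP. Qed.

End ContinuousMaps.

Definition compHaus_category : category :=
  @Category compHaus (fun X Y => continuousType X Y)
    (fun X => cts_id X) (fun X Y Z g f => cts_comp g f)
    (fun X Y f => cts_comp1l f) (fun X Y f => cts_comp1r f)
    (fun X Y Z W h g f => cts_compA h g f).

Section RealValuedMaps.
Variables (R : realType) (X : topologicalType).

Notation CX := (continuousType X R).

Definition cfun_cst (c : R) : CX := @cst X R c.

Lemma cfun_odot_continuous (c : R) (phi : CX) : continuous (fun x => c + phi x).
Proof.
move=> x; apply: (@cvgD R R^o); first exact: cvg_cst.
by have := @cts_fun _ _ phi x.
Qed.

Definition cfun_odot (c : R) (phi : CX) : CX := mkcts (@cfun_odot_continuous c phi).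

Lemma cfun_oplus_continuous (phi psi : CX) :
  continuous (fun x => Num.max (phi x) (psi x)).
Proof.
by move=> x; apply: (@continuous_max R X phi psi x); exact: cts_fun.
Qed.

Definition cfun_oplus (phi psi : CX) : CX := mkcts (@cfun_oplus_continuous phi psi).

Definition is_idem_measure (mu : CX -> R) : Prop :=
  [/\ forall c : R, mu (cfun_cst c) = c,
      forall (c : R) (phi : CX), mu (cfun_odot c phi) = c + mu phi
    & forall phi psi : CX, mu (cfun_oplus phi psi) = Num.max (mu phi) (mu psi)].

Record idem_measure := IdemMeasure {
  idem_fun :> CX -> R;
  idem_funP : is_idem_measure idem_fun }.

HB.instance Definition _ := gen_eqMixin idem_measure.
HB.instance Definition _ := gen_choiceMixin idem_measure.

Lemma idem_measureP (mu nu : idem_measure) : mu =1 nu -> mu = nu.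
Proof.
case: mu nu => [m mP] [n nP] /= /funext mn; rewrite mn in mP *.
by congr IdemMeasure; exact: Prop_irrelevance.
Qed.

Definition weak_star_ball (mu : idem_measure) (n : nat) (phi : 'I_n -> CX)
    (e : R) : set idem_measure :=
  [set nu | forall i, `|mu (phi i) - nu (phi i)| < e].

Definition weak_star_base : set (set idem_measure) :=
  [set U | exists (mu : idem_measure) (n : nat) (phi : 'I_n -> CX) (e : R),
    0 < e /\ U = weak_star_ball mu phi e].

Lemma weak_star_ball_shrink (mu t : idem_measure) (n : nat)
    (phi : 'I_n -> CX) (e : R) : weak_star_ball mu phi e t ->
  \forall d \near 0^'+, weak_star_ball t phi d `<=` weak_star_ball mu phi e.
Proof.
move=> bt.
have sl i : \forall d \near (0 : R)^'+, d < e - `|mu (phi i) - t (phi i)|.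
  by apply: nbhs_right_lt; rewrite subr_gt0.
have : \forall d \near (0 : R)^'+, forall i, d < e - `|mu (phi i) - t (phi i)|.
  exact: filter_forall.
apply: filterS => d dP nu tnu i.
have := dP i; rewrite ltrBrDr addrC; apply: le_lt_trans.
by rewrite (le_trans (ler_distD (t (phi i)) _ _))// lerD2l; exact/ltW/tnu.
Qed.

Lemma weak_star_base_cover : \bigcup_(U in weak_star_base) id U = setT.
Proof.
apply/seteqP; split => // mu _; exists (weak_star_ball mu (fun _ : 'I_0 => cfun_cst 0) 1).
  by exists mu, 0%N, (fun _ : 'I_0 => cfun_cst 0), 1.
by move=> i; rewrite subrr normr0.
Qed.

Lemma weak_star_base_join (U V : set idem_measure) (t : idem_measure) :
  weak_star_base U -> weak_star_base V -> id U t -> id V t ->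
  exists W, [/\ weak_star_base W, id W t & id W `<=` id U `&` id V].
Proof.
move=> [mu [m [phi [d [d0 ->]]]]] [nu [n [psi [e [e0 ->]]]]] Ut Vt.
have : \forall r \near (0 : R)^'+, [/\ 0 < r,
    weak_star_ball t phi r `<=` weak_star_ball mu phi d &
    weak_star_ball t psi r `<=` weak_star_ball nu psi e].
  near=> r; split; near: r; first exact: nbhs_right_gt.
    exact: weak_star_ball_shrink.
  exact: weak_star_ball_shrink.
move=> /filter_ex[r [r0 rU rV]].
pose chi (i : 'I_(m + n)) :=
  match fintype.split i with inl j => phi j | inr j => psi j end.
exists (weak_star_ball t chi r); split; first by exists t, (m + n)%N, chi, r.
  by move=> i; rewrite subrr normr0.
move=> k kt; split.
  apply: rU => i; have := kt (lshift n i).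
  by rewrite /chi (unsplitK (inl i)).
apply: rV => i; have := kt (rshift m i).
by rewrite /chi (unsplitK (inr i)).
Unshelve. all: by end_near. Qed.

HB.instance Definition _ := isBaseTopological.Build idem_measure
  weak_star_base_cover weak_star_base_join.

Lemma weak_star_ball_open (mu : idem_measure) (n : nat) (phi : 'I_n -> CX)
  (e : R) : 0 < e -> open (weak_star_ball mu phi e).
Proof.
move=> e0; exists [set weak_star_ball mu phi e]; last by rewrite bigcup_set1.
by move=> _ ->; exists mu, n, phi, e.
Qed.

Lemma weak_star_nbhsP (mu : idem_measure) (A : set idem_measure) :
  nbhs mu A -> exists (n : nat) (phi : 'I_n -> CX) (e : R),
    0 < e /\ weak_star_ball mu phi e `<=` A.
Proof.
rewrite nbhsE => -[B [[D DB <-] [U DU Umu]] BA].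
have [nu [n [phi [e [e0 UE]]]]] := DB U DU.
have : \forall r \near (0 : R)^'+, 0 < r /\
    weak_star_ball mu phi r `<=` weak_star_ball nu phi e.
  near=> r; split; near: r; first exact: nbhs_right_gt.
  by apply: weak_star_ball_shrink; rewrite -UE.
move=> /filter_ex[r [r0 rU]]; exists n, phi, r; split => //.
by apply: subset_trans BA => k /rU; rewrite -UE => Uk; exists U.
Unshelve. all: by end_near. Qed.

Lemma weak_star_basis : basis weak_star_base.
Proof.
split=> [U [mu [n [phi [e [e0 ->]]]]]|mu A /weak_star_nbhsP[n [phi [e [e0 muA]]]]].
  exact: weak_star_ball_open.
exists (weak_star_ball mu phi e) => //; split; first by exists mu, n, phi, e.
by move=> i; rewrite subrr normr0.
Qed.

Lemma idem_ev_continuous (phi : CX) :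
  continuous (fun mu : idem_measure => mu phi).
Proof.
move=> mu; apply/(@cvgrPdist_lt R R^o _ (nbhs mu) _) => e e0.
have : nbhs mu (weak_star_ball mu (fun _ : 'I_1 => phi) e).
  apply: open_nbhs_nbhs; split; first exact: weak_star_ball_open.
  by move=> i; rewrite subrr normr0.
by apply: filterS => nu /(_ ord0).
Qed.

Lemma cvg_idem_measure (F : set_system idem_measure) (mu : idem_measure) :
  Filter F -> (forall phi, (fun nu : idem_measure => nu phi) @ F --> mu phi) ->
  F --> mu.
Proof.
move=> FF cF A /weak_star_nbhsP[n [phi [e [e0 muA]]]].
apply: filterS muA _; apply: filter_forall => i.
by have /cvgrPdist_lt := cF (phi i); apply.
Qed.

Lemma idem_measure_hausdorff : hausdorff_space idem_measure.
Proof.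
move=> mu nu clmn; apply: idem_measureP => phi.
apply: (@norm_hausdorff R R^o) => A B nA nB.
have [k [kA kB]] := clmn _ _ (idem_ev_continuous nA) (idem_ev_continuous nB).
by exists (k phi).
Qed.

Lemma idem_measure_le (mu : idem_measure) (phi psi : CX) :
  (forall x, phi x <= psi x) -> mu phi <= mu psi.
Proof.
move=> le; have [_ _ muU] := idem_funP mu.
have : cfun_oplus phi psi = psi by apply/continuousEP => x; exact/max_idPr/le.
by move=> E; rewrite -E muU le_max lexx.
Qed.

Lemma idem_measure_compact : compact [set: X] -> compact [set: idem_measure].
Proof.
move=> cX; rewrite compact_ultra => F FU _.
have FP : ProperFilter F by exact: ultra_proper.
have evF phi : exists l : R, (fun nu : idem_measure => nu phi) @ F --> l.
  have [c cphi] : exists c : R, forall x, `|phi x| <= c.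
    have : compact (phi @` [set: X]).
      apply: continuous_compact => //.
      by apply: continuous_subspaceT => x; exact: cts_fun.
    move=> /(@compact_bounded R R^o)[M [_ Mb]]; exists (M + 1) => x.
    by apply: Mb; [rewrite ltrDl|exists x].
  have := @segment_compact R (- c) c ((fun nu : idem_measure => nu phi) @ F) _.
  case.
    apply: (@filterS _ F _ setT); last exact: filterT.
    move=> mu _ /=; have [mucst _ _] := idem_funP mu.
    rewrite in_itv/=; apply/andP; split.
      rewrite -(mucst (- c)); apply: idem_measure_le => x /=.
      by have := cphi x; rewrite ler_norml => /andP[].
    rewrite -(mucst c); apply: idem_measure_le => x /=.
    by have := cphi x; rewrite ler_norml => /andP[].
  move=> l [_ cll]; exists l => U Ul.
  have [//|nU] := in_ultra_setVsetC ((fun nu : idem_measure => nu phi) @^-1` U) FU.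
  by have [y [ny yU]] := cll (~` U) U nU Ul.
have [L LF] := choice evF.
have LP : is_idem_measure L.
  have H : hausdorff_space R^o := @norm_hausdorff R R^o.
  split.
  - move=> c; apply: (cvg_unique H (LF (cfun_cst c))).
    have -> : (fun nu : idem_measure => nu (cfun_cst c)) = cst c.
      by apply/funext => nu; have [-> _ _] := idem_funP nu.
    exact: cvg_cst.
  - move=> c phi; apply: (cvg_unique H (LF (cfun_odot c phi))).
    have -> : (fun nu : idem_measure => nu (cfun_odot c phi)) =
        (fun nu => c + nu phi).
      by apply/funext => nu; have [_ -> _] := idem_funP nu.
    by apply: (@cvgD R R^o); [exact: cvg_cst|exact: LF].
  - move=> phi psi; apply: (cvg_unique H (LF (cfun_oplus phi psi))).
    have -> : (fun nu : idem_measure => nu (cfun_oplus phi psi)) =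
        (fun nu => (nu phi + nu psi + `|nu phi - nu psi|) / 2).
      by apply/funext => nu; have [_ _ ->] := idem_funP nu; rewrite maxr_absE.
    rewrite maxr_absE; apply: (@cvgMl R _ F _); apply: (@cvgD R R^o).
      by apply: (@cvgD R R^o); exact: LF.
    by apply: (@cvg_norm R R^o); apply: (@cvgB R R^o); exact: LF.
exists (IdemMeasure LP); split => //=.
exact: cvg_idem_measure.
Qed.

End RealValuedMaps.

Arguments weak_star_ball {R X} mu {n} phi e.

Section IdemFunctor.
Variable R : realType.

Definition idem_obj (X : compHaus) : compHaus :=
  @CompHaus (idem_measure R X)
    (idem_measure_compact (@ch_compact X)) (@idem_measure_hausdorff R X).

Section Map.
Variables (X Y : topologicalType) (f : continuousType X Y).

Lemma idem_map_subproof (mu : idem_measure R X) :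
  is_idem_measure (fun phi : continuousType Y R => mu (cts_comp phi f)).
Proof.
have [mu1 mu2 mu3] := idem_funP mu; split.
- by move=> c; rewrite -[RHS]mu1; congr (mu _); exact/continuousEP.
- by move=> c phi; rewrite -mu2; congr (mu _); exact/continuousEP.
- by move=> phi psi; rewrite -mu3; congr (mu _); exact/continuousEP.
Qed.

Definition idem_map (mu : idem_measure R X) : idem_measure R Y :=
  IdemMeasure (idem_map_subproof mu).

Lemma idem_map_continuous : continuous idem_map.
Proof.
move=> mu; apply: (@cvg_idem_measure R Y (idem_map @ mu)).
  exact: (@fmap_filter _ _ idem_map (nbhs mu)).
by move=> phi; exact: (@idem_ev_continuous R X (cts_comp phi f) mu).
Qed.

Definition idem_cmap : continuousType (idem_measure R X) (idem_measure R Y) :=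
  mkcts (@idem_map_continuous).

End Map.

Lemma idem_cmap1 (X : topologicalType) :
  idem_cmap (cts_id X) = cts_id (idem_measure R X).
Proof.
apply/continuousEP => mu; apply: idem_measureP => phi /=.
by congr (mu _); exact/continuousEP.
Qed.

Lemma idem_cmapM (X Y Z : topologicalType) (g : continuousType Y Z)
    (f : continuousType X Y) :
  idem_cmap (cts_comp g f) = cts_comp (idem_cmap g) (idem_cmap f).
Proof.
apply/continuousEP => mu; apply: idem_measureP => phi /=.
by congr (mu _); exact/continuousEP.
Qed.

Definition idem_functor : functor compHaus_category compHaus_category :=
  @Functor compHaus_category compHaus_category idem_obj
    (fun X Y f => idem_cmap f)
    (fun X => idem_cmap1 X) (fun X Y Z g f => idem_cmapM g f).

(* \bar\phi : mu |-> mu(phi) *)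
Definition idem_ev (X : topologicalType) (phi : continuousType X R) :
  continuousType (idem_measure R X) R := mkcts (@idem_ev_continuous R X phi).

End IdemFunctor.

(* Main.v *)
Require Import Defs.
From mathcomp Require Import all_boot all_order all_algebra.
From mathcomp Require Import all_classical all_reals all_analysis.
Import numFieldNormedType.Exports.

(** The construction is double dualization [X |-> (C(X) -> R)] cut down to the
    functionals that respect the idempotent operations: the unit is evaluation
    at a point, and the multiplication precomposes a functional on [C(I(X))]
    with [idem_ev : C(X) -> C(I(X))].  Two things have to be checked.

    First, the unit and the multiplication land in idempotent measures and are
    continuous.  The former holds because the operations on [C(X)] are
    pointwise and [idem_ev] preserves constants, [c (.) phi] and [phi (+) psi];
    this is precisely the definition of an idempotent measure, read with the
    measure as the variable.  The latter holds because a map into the weak*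
    topology is continuous as soon as its composite with each evaluation is,
    and these composites are [phi] itself for the unit and [idem_ev (idem_ev
    phi)] for the multiplication.

    Second, naturality and the three monad laws.  Applied to a measure and a
    test function, both sides of each law are the same measure applied to two
    continuous functions with the same values at every point, so each law
    needs at most [idem_measure_ext]. *)

Section DiracAndBarycenter.
Variables (R : realType) (X : topologicalType).

Lemma idem_measure_ext (mu : idem_measure R X) (phi psi : continuousType X R) :
  phi =1 psi -> mu phi = mu psi.
Proof. by move=> e; congr (mu _); exact/continuousEP. Qed.

(** The weak* topology is initial for the evaluations [nu |-> nu phi]. *)
Lemma continuous_to_idem_measure (T : topologicalType)
    (h : T -> idem_measure R X) :
  (forall phi, continuous (fun t => h t phi)) -> continuous h.
Proof.
move=> hc t; apply: (@cvg_idem_measure R X (h @ t)%classic).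
by move=> phi; exact: hc.
Qed.

Lemma dirac_subproof (x : X) :
  is_idem_measure (fun phi : continuousType X R => phi x).
Proof. by []. Qed.

Definition idem_dirac (x : X) : idem_measure R X :=
  IdemMeasure (dirac_subproof x).

Lemma idem_dirac_continuous : continuous idem_dirac.
Proof. by apply: continuous_to_idem_measure => phi; exact: cts_fun. Qed.

Definition idem_unit : continuousType X (idem_measure R X) :=
  mkcts idem_dirac_continuous.

(** Each axiom for [M] is used at functions of the form [idem_ev phi]; the
    matching axiom for the points [mu] of [I(X)] identifies the operation on
    [idem_ev phi] with [idem_ev] of the operation on [phi]. *)
Lemma barycenter_subproof (M : idem_measure R (idem_measure R X)) :
  is_idem_measure (fun phi : continuousType X R => M (idem_ev phi)).
Proof.
have [M_cst M_odot M_oplus] := idem_funP M; split.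
- move=> c; rewrite -[RHS]M_cst; congr (M _).
  apply/continuousEP => mu; have [mu_cst _ _] := idem_funP mu; exact: mu_cst.
- move=> c phi; rewrite -M_odot; congr (M _).
  apply/continuousEP => mu; have [_ mu_odot _] := idem_funP mu; exact: mu_odot.
- move=> phi psi; rewrite -M_oplus; congr (M _).
  apply/continuousEP => mu; have [_ _ mu_oplus] := idem_funP mu; exact: mu_oplus.
Qed.

Definition idem_barycenter (M : idem_measure R (idem_measure R X)) :
  idem_measure R X := IdemMeasure (barycenter_subproof M).

Lemma idem_barycenter_continuous : continuous idem_barycenter.
Proof.
apply: continuous_to_idem_measure => phi.
exact: (@idem_ev_continuous R (idem_measure R X) (idem_ev phi)).
Qed.

Definition idem_mult :
  continuousType (idem_measure R (idem_measure R X)) (idem_measure R X) :=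
  mkcts idem_barycenter_continuous.

End DiracAndBarycenter.

Section Naturality.
Variables (R : realType) (X Y : topologicalType) (f : continuousType X Y).

Lemma idem_unit_natural :
  cts_comp (idem_unit R Y) f = cts_comp (idem_cmap R f) (idem_unit R X).
Proof. by apply/continuousEP => x; exact: idem_measureP. Qed.

Lemma idem_mult_natural :
  cts_comp (idem_mult R Y) (idem_cmap R (idem_cmap R f)) =
  cts_comp (idem_cmap R f) (idem_mult R X).
Proof.
apply/continuousEP => M; apply: idem_measureP => phi.
exact: (idem_measure_ext _ _ M).
Qed.

End Naturality.

Section MonadLaws.
Variables (R : realType) (X : topologicalType).

Lemma idem_mult_map_unit :
  cts_comp (idem_mult R X) (idem_cmap R (idem_unit R X)) =
  cts_id (idem_measure R X).
Proof.
apply/continuousEP => mu; apply: idem_measureP => phi.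
exact: (idem_measure_ext _ _ mu).
Qed.

Lemma idem_mult_unit :
  cts_comp (idem_mult R X) (idem_unit R (idem_measure R X)) =
  cts_id (idem_measure R X).
Proof. by apply/continuousEP => mu; exact: idem_measureP. Qed.

(** At [N] and [phi] the two sides are [N] applied to [idem_ev (idem_ev phi)]
    and to [idem_ev phi \o idem_mult R X]; both send [M] to [M (idem_ev phi)]. *)
Lemma idem_mult_assoc :
  cts_comp (idem_mult R X) (idem_mult R (idem_measure R X)) =
  cts_comp (idem_mult R X) (idem_cmap R (idem_mult R X)).
Proof.
apply/continuousEP => N; apply: idem_measureP => phi.
exact: (idem_measure_ext _ _ N).
Qed.

End MonadLaws.

Theorem theorem3p4 (R : realType) :
  exists (eta : nat_trans (id_functor compHaus_category) (idem_functor R))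
         (zeta : nat_trans (comp_functor (idem_functor R) (idem_functor R))
                           (idem_functor R)),
    [/\ forall (X : compHaus) (x : X) (phi : continuousType X R),
          eta X x phi = phi x,
        forall (X : compHaus) (M : idem_obj R (idem_obj R X))
               (phi : continuousType X R),
          zeta X M phi = M (idem_ev phi)
      & is_monad eta zeta].
Proof.
exists (@NatTrans _ _ (id_functor compHaus_category) (idem_functor R)
  (fun X : compHaus => idem_unit R X)
  (fun (X Y : compHaus) f => @idem_unit_natural R X Y f)).
exists (@NatTrans _ _ (comp_functor (idem_functor R) (idem_functor R))
  (idem_functor R) (fun X : compHaus => idem_mult R X)
  (fun (X Y : compHaus) f => @idem_mult_natural R X Y f)).
split=> //; split=> X.
- exact: idem_mult_map_unit.
- exact: idem_mult_unit.
- exact: idem_mult_assoc.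
Qed.
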